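(* Let $p$ be an odd prime and $G$ an extraspecial $p$-group of exponent $p^2$, with $V,B,T$ and a special symplectic basis $\{v_1,w_1,\dots,v_n,w_n\}$ as in the context. (i) Let $g,h\in G$ with $gZ(G),hZ(G)\notin\mathrm{span}(w_1)\setminus\{0\}$. Then $g$ and $h$ are automorphic if and only if they have the same order and ($g\in Z(G)\iff h\in Z(G)$). (ii) The number of orbits of the natural action of $\mathrm{Aut}(G)$ on $G$ is $p+2$ if $|G|=p^3$, and $p+3$ if $|G|>p^3$.
   Context: A special $p$-group is a finite $p$-group whose center, derived subgroup and Frattini subgroup coincide and are elementary abelian; it is extraspecial if $|Z(G)|=p$. $V=G/Z(G)$ as a $GF(p)$-vector space, $Z(G)$ identified with $GF(p)$, $B(gZ(G),hZ(G))=[g,h]=ghg^{-1}h^{-1}$, $T(gZ(G))=g^p$. A special symplectic basis is a basis $\{v_1,w_1,\dots,v_n,w_n\}$ of $V$ with $B(v_i,w_i)=1$, $B(v_i,w_j)=B(v_i,v_j)=B(w_i,w_j)=0$ for $i\ne j$, $T(v_1)=1$ and $T(u)=0$ for all other basis vectors $u$; such a basis exists. Elements $g,h$ are automorphic if $\varphi(g)=h$ for some $\varphi\in\mathrm{Aut}(G)$. *)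

(* Defs.v *)
From mathcomp Require Import all_boot all_fingroup all_solvable.
Set Implicit Arguments. Unset Strict Implicit. Unset Printing Implicit Defensive.
Local Open Scope group_scope.

(* Paper's commutator convention: [g,h] = g h g^-1 h^-1. *)
Definition pcomm (gT : finGroupType) (g h : gT) : gT := g * h * g^-1 * h^-1.

(* Special symplectic basis {v_1,w_1,...,v_n,w_n} of V = G/Z(G), given by
   representatives v i, w i ((1 <= i <= n)%N) in G.  Z(G) is identified with
   GF(p) via the generator z |-> 1.  B(xZ,yZ) = pcomm x y, T(xZ) = x^p. *)
Definition special_symplectic_basis (gT : finGroupType) (p : nat)
    (G : {group gT}) (z : gT) (n : nat) (v w : nat -> gT) : Prop :=
  [/\ z \in 'Z(G), z != 1, (1 <= n)%N &
   [/\
      (forall i, (1 <= i <= n)%N -> v i \in G /\ w i \in G),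
      (* the family spans V and has dim V = 2n elements, so it is a basis *)
      << coset 'Z(G) @: [set x | [exists i : 'I_n.+1,
             (0 < i)%N && ((x == v i) || (x == w i))]] >> = G / 'Z(G)
      /\ #|G / 'Z(G)| = (p ^ (2 * n))%N,
      (forall i, (1 <= i <= n)%N -> pcomm (v i) (w i) = z),
      (forall i j, (1 <= i <= n)%N -> (1 <= j <= n)%N -> i != j ->
         [/\ pcomm (v i) (w j) = 1, pcomm (v i) (v j) = 1 &
             pcomm (w i) (w j) = 1]) &
      (v 1%N ^+ p = z /\
       (forall i, (2 <= i <= n)%N -> v i ^+ p = 1) /\
       (forall i, (1 <= i <= n)%N -> w i ^+ p = 1))]].

Definition in_span_w1_nonzero (gT : finGroupType) (G : {group gT})
    (w : nat -> gT) (g : gT) : bool :=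
  (coset 'Z(G) g \in <[coset 'Z(G) (w 1%N)]>) && (coset 'Z(G) g != 1).

Definition automorphic (gT : finGroupType) (G : {group gT}) (g h : gT) : Prop :=
  exists2 f, f \in Aut G & f g = h.

Definition num_aut_orbits (gT : finGroupType) (G : {group gT}) : nat :=
  #|[set orbit 'P (Aut G) x | x in G]|.

(* Main.v *)
Require Import Defs.
From mathcomp Require Import all_boot all_fingroup all_solvable.

(** Commutators make V = G / Z(G) a symplectic space over GF(p), and since p is
    odd, T : u |-> u ^+ p is a linear functional on V, so T(u) = B(w, u) for
    one vector w (for a special symplectic basis, w = - w_1).  The elements of
    exponent p form K = 'C_G[w], and 'C_G(K) = <[w]> Z(G).

    Automorphisms are produced as subgroups of G x G: if pairs (a_i, a_i')
    satisfy the same commutator and p-th power relations and both families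
    generate G, the subgroup generated by the pairs has order at most #|G| and
    projects onto both factors, so it is the graph of an automorphism.
    Splitting off hyperbolic planes, the first one containing w, yields such
    families and shows that Z(G) \ 1, G \ K and K \ 'C_G(K) are single orbits.
    Elements of 'C_G(K) outside Z(G) are conjugate to powers of w, and the
    relation [~ w ^+ n, u] = (u ^+ p) ^+ n shows that n mod p is invariant.
    The orbits are thus represented by the p powers of w, one nontrivial central
    element, one element of order p ^ 2 and, unless K is abelian, i.e.,
    #|G| = p ^ 3, one element of K \ 'C_G(K). *)

Set Implicit Arguments. Unset Strict Implicit. Unset Printing Implicit Defensive.
Local Open Scope group_scope.

(** * The commutator form and hyperbolic planes *)

Section CommutatorForm.

Variables (p : nat) (gT : finGroupType).
Hypothesis p_pr : prime p.

(** Commutation then induces a nondegenerate alternating form on [E / <[z]>], and [z] identifies its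
    values with GF(p). The case [E = <[z]>] is allowed, so that inductions on complements can end
    there. *)
Definition symplectic (z : gT) (E : {set gT}) :=
  [/\ #[z] = p, 'Z(E) = <[z]> & E^`(1) \subset <[z]>].

Variables (z : gT) (E : {group gT}).
Hypothesis sE : symplectic z E.

Lemma symplectic_center_sub : <[z]> \subset E.
Proof. by have [_ <- _] := sE; apply: center_sub. Qed.

Lemma symplectic_commutes a c :
  a \in E -> c \in <[z]> -> commute a c.
Proof.
have [_ defZ _] := sE; rewrite -defZ => Ea /centerP[_ cE].
exact/commute_sym/cE.
Qed.

Lemma symplectic_comm a b : a \in E -> b \in E -> [~ a, b] \in <[z]>.
Proof.
have [_ _ sD] := sE => Ea Eb.
exact/(subsetP sD)/mem_commg.
Qed.

Lemma symplectic_commM a b c : a \in E -> b \in E -> c \in E ->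
  [~ a, b * c] = [~ a, b] * [~ a, c].
Proof.
move=> Ea Eb Ec; have Zab := symplectic_comm Ea Eb.
have Zac := symplectic_comm Ea Ec.
rewrite commgMJ /conjg -(symplectic_commutes Ec Zab) mulKg.
exact: symplectic_commutes (subsetP symplectic_center_sub _ Zac) Zab.
Qed.

Lemma symplectic_commX a b n : a \in E -> b \in E ->
  [~ a, b ^+ n] = [~ a, b] ^+ n.
Proof.
move=> Ea Eb; apply/commgX/symplectic_commutes => //.
exact: symplectic_comm.
Qed.

Lemma symplectic_pow c d : c \in <[z]> -> c != 1 -> d \in <[z]> ->
  exists n, d = c ^+ n.
Proof.
have [oz _ _] := sE => Zc ntc Zd.
suff: d \in <[c]> by case/cycleP=> n ->; exists n.
have -> // : <[c]> = <[z]>.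
apply/eqP; rewrite eqEcard cycle_subG Zc /=.
have: #[c] %| p by rewrite -oz order_dvdG.
by case/primeP: p_pr => _ /[apply]; rewrite order_eq1 (negbTE ntc) -!orderE oz => /eqP->.
Qed.

(** The map [u |-> [~ a, u]] is a nontrivial homomorphism into a group of prime order, hence
    onto. *)
Lemma symplectic_comm_onto (U : {group gT}) a c :
  U \subset E -> a \in E -> a \notin 'C(U) -> c \in <[z]> ->
  exists2 b, b \in U & [~ a, b] = c.
Proof.
move=> sUE Ea /centP ncUa Zc.
have /existsP[b /andP[Ub ntab]] : [exists b, (b \in U) && ([~ a, b] != 1)].
  apply/existsPn=> cU; apply: ncUa => b Ub; apply/commgP.
  by have:= cU b; rewrite Ub /= negbK.
have Eb := subsetP sUE _ Ub.
have [n ->] := symplectic_pow (symplectic_comm Ea Eb) ntab Zc.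
by exists (b ^+ n); rewrite ?groupX ?symplectic_commX.
Qed.

(** The class of [a] under [U] is the whole coset [a *: <[z]>]. *)
Lemma symplectic_index (U : {group gT}) a :
  U \subset E -> a \in E -> a \notin 'C(U) ->
  #|U : 'C_U[a]| = p.
Proof.
have [oz _ _] := sE; move=> sUE Ea ncUa; rewrite index_cent1.
suff -> : a ^: U = a *: <[z]> by rewrite card_lcoset -orderE.
apply/setP=> b; apply/imsetP/lcosetP=> [[u Uu ->]|[c Zc ->]].
  exists [~ a, u]; [exact: symplectic_comm (subsetP sUE _ Uu)|by rewrite -conjg_mulR].
have [u Uu <-] := symplectic_comm_onto sUE Ea ncUa Zc.
by exists u; rewrite ?conjg_mulR.
Qed.

(** Projection along [b]: some [n] solves [[~ a, u] * [~ a, b] ^+ n = 1]. *)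
Lemma symplectic_split (U : {group gT}) a b u :
  U \subset E -> a \in E -> b \in U -> [~ a, b] != 1 -> u \in U ->
  exists n, u * b ^+ n \in 'C_U[a].
Proof.
move=> sUE Ea Ub ntab Uu.
have [Eb Eu] := (subsetP sUE _ Ub, subsetP sUE _ Uu).
have Zau: [~ a, u]^-1 \in <[z]> by rewrite groupV symplectic_comm.
have [n def_au] := symplectic_pow (symplectic_comm Ea Eb) ntab Zau.
exists n; rewrite inE groupM ?groupX //=; apply/cent1P/commute_sym/commgP.
by rewrite symplectic_commM ?groupX // symplectic_commX // -def_au mulgV.
Qed.

Section HyperbolicPair.

Variables a b : gT.
Hypotheses (Ea : a \in E) (Eb : b \in E) (ab_z : [~ a, b] = z).

Let E0 := 'C_E([set a; b]).

Let mem_E0 u : (u \in E0) = [&& u \in E, u \in 'C[a] & u \in 'C[b]].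
Proof. by rewrite inE centU !cent_set1 inE. Qed.

Let z_neq1 : z != 1.
Proof. by have [oz _ _] := sE; rewrite -order_gt1 oz prime_gt1. Qed.

Let defE0 : E0 = 'C_('C_E[a])[b].
Proof. by apply/setP=> u; rewrite mem_E0 !inE andbA. Qed.

Let Ca_b : b \notin 'C('C_E[a]).
Proof.
apply/centP=> /(_ a); rewrite inE Ea cent1id => /(_ isT)/commute_sym/commgP.
by rewrite ab_z (negbTE z_neq1).
Qed.

(** Gram-Schmidt: a power of [b] makes [u] commute with [a]; then a power of [a], which does not
    spoil this, makes it commute with [b]. *)
Lemma hyperbolic_split u : u \in E ->
  exists i j, u * b ^+ i * a ^+ j \in E0.
Proof.
move=> Eu; have [|i C_ub] := symplectic_split (subxx E) Ea Eb _ Eu.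
  by rewrite ab_z.
have C_a: a \in 'C_E[a] by rewrite inE Ea cent1id.
have [|j] := symplectic_split (subsetIl E 'C[a]) Eb C_a _ C_ub.
  by rewrite -invg_comm ab_z eq_invg1.
by exists i, j; rewrite defE0.
Qed.

Lemma hyperbolic_symplectic : symplectic z E0.
Proof.
have [oz defZ sD] := sE; split=> //; last first.
  by apply: subset_trans sD; apply/dergS/subsetIl.
apply/eqP; rewrite eqEsubset -{1}defZ; apply/andP; split.
  apply/subsetP=> c /setIP[E0c /centP cE0].
  move: (E0c); rewrite mem_E0 => /and3P[Ec /cent1P cac /cent1P cbc].
  rewrite inE Ec; apply/centP=> u Eu; have [i [j /cE0 cu]] := hyperbolic_split Eu.
  apply: (mulIg (b ^+ i * a ^+ j)).
  have cba : commute c (b ^+ i * a ^+ j) by apply: commuteM; apply: commuteX.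
  rewrite -[RHS]mulgA cba -mulgA [u * (_ * c)]mulgA [u * (_ * _)]mulgA.
  exact: cu.
rewrite -defZ; apply/subsetP=> c /centerP[Ec cEc].
have E0c: c \in E0.
  by rewrite mem_E0 Ec /=; apply/andP; split; apply/cent1P; apply: cEc.
rewrite inE E0c; apply/centP=> u; rewrite mem_E0 => /and3P[Eu _ _].
exact: cEc.
Qed.

Lemma hyperbolic_gen : (E0 <*> <[b]>) <*> <[a]> = E.
Proof.
apply/eqP; rewrite eqEsubset !join_subG !cycle_subG subsetIl Ea Eb /=.
apply/subsetP=> u Eu; have [i [j E0u]] := hyperbolic_split Eu.
have Ga: a \in E0 <*> <[b]> <*> <[a]> by rewrite mem_gen // inE cycle_id orbT.
have Gb: b \in E0 <*> <[b]> <*> <[a]>.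
  by rewrite mem_gen // inE mem_gen // inE cycle_id orbT.
rewrite -(groupMr _ (groupX i Gb)) -(groupMr _ (groupX j Ga)).
by rewrite mem_gen // inE mem_gen // inE E0u.
Qed.

(** Centralizing [a] and then [b] costs a factor [p] each time, since [b] does not centralize
    ['C_E[a]], which contains [a]. *)
Lemma hyperbolic_card : #|E| = (p * (p * #|E0|))%N.
Proof.
have Ca: a \notin 'C(E).
  by apply/centP=> /(_ b Eb)/commgP; rewrite ab_z (negbTE z_neq1).
rewrite -(Lagrange (subsetIl E 'C[a])) symplectic_index // mulnC; congr (_ * _)%N.
rewrite -(Lagrange (subsetIl 'C_E[a] 'C[b])) symplectic_index ?subsetIl //.
by rewrite mulnC defE0.
Qed.

End HyperbolicPair.

End CommutatorForm.

(** * Graphs of isomorphisms in direct products *)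

Lemma card_joing_cycle (gT : finGroupType) (H : {group gT}) a n :
  a \in 'N(H) -> a ^+ n \in H -> 0 < n -> #|H <*> <[a]>| <= n * #|H|.
Proof.
move=> nHa Han n_gt0.
have nHA: <[a]> \subset 'N(H) by rewrite cycle_subG.
rewrite joingC norm_joinEl // -LagrangeMr leq_mul2r -card_quotient //.
apply/orP; right; rewrite quotient_cycle // -orderE dvdn_leq //.
by rewrite order_dvdn -morphX /= ?coset_id.
Qed.

Lemma expg_pair (gT rT : finGroupType) (a : gT) (b : rT) n :
  (a, b) ^+ n = (a ^+ n, b ^+ n).
Proof. by elim: n => // n IHn; rewrite !expgS IHn. Qed.

Section Isograph.

Variables gT rT : finGroupType.

(* The cardinality bound makes [fst] injective on [Gamma], so that [Gamma] is
   the graph of a morphism. *)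
Definition isograph (E : {set gT}) (E' : {set rT}) (Gamma : {group gT * rT}) :=
  [/\ fst @* Gamma = E, snd @* Gamma = E' & #|Gamma| <= #|E|].

(** Adjoining [(b, b')] and then [(a, a')] multiplies the order of [Gamma0] by at most [p] each
    time, because their p-th powers lie in [Gamma0]. The order of [E] is exactly [p ^ 2] times that
    of the complement, so the cardinality bound persists. *)
Lemma isograph_hyperbolic (p : nat) (z : gT) (z' : rT) (E : {group gT})
    (E' : {group rT}) a b a' b' Gamma0 :
  prime p -> symplectic p z E -> symplectic p z' E' ->
  a \in E -> b \in E -> [~ a, b] = z ->
  a' \in E' -> b' \in E' -> [~ a', b'] = z' ->
  isograph 'C_E([set a; b]) 'C_E'([set a'; b']) Gamma0 ->
  (z, z') \in Gamma0 -> (a ^+ p, a' ^+ p) \in Gamma0 ->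
  (b ^+ p, b' ^+ p) \in Gamma0 ->
  exists Gamma, [/\ isograph E E' Gamma, (a, a') \in Gamma,
    (b, b') \in Gamma & Gamma0 \subset Gamma].
Proof.
move=> p_pr sE sE' Ea Eb ab_z Ea' Eb' ab_z' [im1 im2 card0] Gz; rewrite -!expg_pair => Ga Gb.
pose H := (Gamma0 <*> <[(b, b')]>)%G; pose Gamma := (H <*> <[(a, a')]>)%G.
have cE0 g : g \in Gamma0 ->
    [/\ commute g.1 a, commute g.1 b, commute g.2 a' & commute g.2 b'].
  move=> G0g; have: g.1 \in fst @* Gamma0 by rewrite mem_morphim ?inE.
  have: g.2 \in snd @* Gamma0 by rewrite mem_morphim ?inE.
  rewrite im1 im2 !centU !cent_set1 !in_setI.
  case/and3P=> _ /cent1P ca' /cent1P cb' /and3P[_ /cent1P ca /cent1P cb].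
  by split; apply/commute_sym.
have cGb: (b, b') \in 'C(Gamma0).
  apply/centP=> g /cE0[_ cb _ cb']; apply/commute_sym.
  by case: g => g1 g2 in cb cb' *; congr (_, _).
have cGa: (a, a') \in 'C(Gamma0).
  apply/centP=> g /cE0[ca _ ca' _]; apply/commute_sym.
  by case: g => g1 g2 in ca ca' *; congr (_, _).
have Hb: (b, b') \in H by rewrite mem_gen // inE cycle_id orbT.
have sGH: Gamma0 \subset H by apply: joing_subl.
(* Conjugation by [(a, a')] fixes [Gamma0] pointwise and multiplies [(b, b')] by the inverse of
   [(z, z')], which lies in [Gamma0]. *)
have nHa: (a, a') \in 'N(H).
  have cGaS: Gamma0 :^ (a, a') = Gamma0 by apply/normP/(subsetP (cent_sub _)).
  rewrite inE /= conjYg cGaS -cycleJ join_subG sGH cycle_subG /=.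
  rewrite conjg_mulR groupM // -invg_comm groupV (subsetP sGH) //.
  by rewrite (_ : [~ _, _] = (z, z')) // -ab_z -ab_z'.
have p_gt0 := prime_gt0 p_pr.
have sHG: H \subset Gamma by apply: joing_subl.
exists Gamma; split; last 1 first.
- exact: subset_trans sGH sHG.
- split.
  + rewrite !morphimY ?subsetT // !morphim_cycle ?inE // im1 /=.
    exact: (hyperbolic_gen p_pr sE).
  + rewrite !morphimY ?subsetT // !morphim_cycle ?inE // im2 /=.
    exact: (hyperbolic_gen p_pr sE').
  rewrite (hyperbolic_card p_pr sE Ea Eb ab_z).
  have nGb: (b, b') \in 'N(Gamma0) by apply: (subsetP (cent_sub _)).
  apply: leq_trans (card_joing_cycle nHa (subsetP sGH _ Ga) p_gt0) _.
  rewrite leq_mul2l (leq_trans (card_joing_cycle nGb Gb p_gt0)) ?orbT //.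
  by rewrite leq_mul2l card0 orbT.
- by rewrite mem_gen // inE cycle_id orbT.
- exact: subsetP sHG _ Hb.
Qed.

(* The marked pair is [(z, z')] when no pair needs to be prescribed: this is
   the form used by the induction on the complement of a hyperbolic plane. *)
Lemma isograph_exponent (p : nat) (z : gT) (z' : rT) (E : {group gT})
    (E' : {group rT}) a a' :
  prime p -> symplectic p z E -> symplectic p z' E' -> #|E| = #|E'| ->
  {in E, forall u, u ^+ p = 1} -> {in E', forall u, u ^+ p = 1} ->
  (a = z /\ a' = z') \/ (a \in E :\: 'C(E) /\ a' \in E' :\: 'C(E')) ->
  exists Gamma, [/\ isograph E E' Gamma, (z, z') \in Gamma & (a, a') \in Gamma].
Proof.
move=> p_pr; have [m] := ubnP #|E|.
elim: m => // m IHm in E E' a a' * => leEm sE sE' eqEE' expE expE' defa.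
have [[oz defZ _] [oz' defZ' _]] := (sE, sE').
have [abE | nabE] := boolP (abelian E).
  have{defa} [-> ->] : a = z /\ a' = z'.
    by case: defa => // [[/setDP[/(subsetP abE)->]]].
  have defE: E :=: <[z]> by rewrite -defZ; apply/esym/center_idP.
  have defE': E' :=: <[z']>.
    apply/esym/eqP; rewrite eqEcard -defZ' center_sub -eqEE' defE defZ'.
    by rewrite -!orderE oz oz' /=.
  exists <[(z, z')]>%G; split; rewrite ?cycle_id //.
  split; rewrite ?morphim_cycle ?inE //= defE -!orderE oz dvdn_leq ?prime_gt0 //.
  by rewrite order_dvdn expg_pair -{1}oz -oz' !expg_order.
have nabE': ~~ abelian E'.
  apply: contra nabE => /center_idP; rewrite defZ' => defE'.
  suff <- : 'Z(E) = E by apply: center_abelian.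
  by apply/eqP; rewrite eqEcard center_sub eqEE' -defE' defZ -!orderE oz oz' /=.
(* The pair [(c, c')] starts the next hyperbolic planes: it is the prescribed pair if that one is
   noncentral, and arbitrary otherwise. *)
have [c [c' [[Ec cEc] [Ec' cEc'] defac]]] : exists c c',
    [/\ c \in E /\ c \notin 'C(E), c' \in E' /\ c' \notin 'C(E')
      & (a, a') = (z, z') \/ (a, a') = (c, c')].
  case: defa => [[-> ->] | [/setDP Ea /setDP Ea']]; last first.
    by exists a, a'; split=> //; right.
  have [[c Ec cEc] [c' Ec' cEc']] := (subsetPn nabE, subsetPn nabE').
  by exists c, c'; split=> //; left.
have [b Eb cb_z] := symplectic_comm_onto p_pr sE (subxx E) Ec cEc (cycle_id z).
have [b' Eb' cb_z'] :=
  symplectic_comm_onto p_pr sE' (subxx E') Ec' cEc' (cycle_id z').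
have cardE := hyperbolic_card p_pr sE Ec Eb cb_z.
have cardE' := hyperbolic_card p_pr sE' Ec' Eb' cb_z'.
have p_gt1 := prime_gt1 p_pr.
have [|||||||Gamma0 [iso0 Gz _]] :=
  IHm 'C_E([set c; b])%G 'C_E'([set c'; b'])%G z z'.
- rewrite -ltnS; apply: leq_trans leEm; rewrite ltnS cardE /=.
  by rewrite mulnA ltn_Pmull ?cardG_gt0 // (ltn_mul p_gt1 p_gt1).
- exact: hyperbolic_symplectic cb_z.
- exact: hyperbolic_symplectic cb_z'.
- apply/eqP; rewrite -(eqn_pmul2l (prime_gt0 p_pr)) -(eqn_pmul2l (prime_gt0 p_pr)).
  by rewrite -cardE -cardE' eqEE'.
- by move=> u /setIP[/expE].
- by move=> u /setIP[/expE'].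
- by left.
have [||Gamma [isoG Gc _ /subsetP sG0]] :=
  isograph_hyperbolic p_pr sE sE' Ec Eb cb_z Ec' Eb' cb_z' iso0 Gz.
- by rewrite expE ?expE' // group1.
- by rewrite expE ?expE' // group1.
by exists Gamma; split; [|exact: sG0|case: defac => -> //; apply: sG0].
Qed.

End Isograph.

(** Both projections of [Gamma] onto [G] are injective by the order bound; the automorphism is the
    inverse of the first followed by the second. *)
Lemma isograph_aut (gT : finGroupType) (G : {group gT}) Gamma :
  isograph G G Gamma ->
  exists2 f, f \in Aut G & {in Gamma, forall g, f g.1 = g.2}.
Proof.
case=> im1 im2 cardG.
pose f1 := restrm (subsetT Gamma) (fst_morphism gT gT).
pose f2 := restrm (subsetT Gamma) (snd_morphism gT gT).
have imf1: f1 @* Gamma = G by rewrite morphim_restrm setIid.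
have imf2: f2 @* Gamma = G by rewrite morphim_restrm setIid.
have injf1: 'injm f1.
  by rewrite -card_im_injm eqn_leq leq_morphim imf1 cardG.
have injf2: 'injm f2.
  by rewrite -card_im_injm eqn_leq leq_morphim imf2 cardG.
have imV: invm injf1 @* G = Gamma.
  by move: imf1 => /esym; move: (G : {set gT}) => _ ->; apply: morphim_invm.
have imG: G \subset invm injf1 @*^-1 Gamma.
  by rewrite -sub_morphim_pre /= ?imV /= ?imf1.
pose f := restrm imG (f2 \o invm injf1).
have injf: 'injm f by rewrite injm_restrm ?injm_comp ?injm_invm.
have imf: f @* G = G.
  by rewrite morphim_restrm setIid morphim_comp imV.
exists (aut injf imf); first exact: Aut_aut.
move=> g Gg; have Gg1: g.1 \in G by rewrite -imf1 (mem_morphim f1).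
have defg: invm injf1 g.1 = g := invmE injf1 Gg.
by rewrite autE // -[in RHS]defg.
Qed.

(** * The p-th power map as a linear functional *)

Section ExtraspecialExponentP2.

Variables (gT : finGroupType) (p : nat) (G : {group gT}).
Hypotheses (p_pr : prime p) (p_odd : odd p) (pG : p.-group G).
Hypotheses (esG : extraspecial G) (expG : exponent G = (p ^ 2)%N).

Lemma extraspecial_symplectic z : z \in 'Z(G) -> z != 1 -> symplectic p z G.
Proof.
move=> Zz ntz; have oZ := card_center_extraspecial pG esG.
have oz: #[z] = p.
  apply/prime_nt_dvdP; rewrite ?order_eq1 //.
  by rewrite -oZ order_dvdG.
have defZ: 'Z(G) = <[z]>.
  by apply/esym/eqP; rewrite eqEcard cycle_subG Zz oZ -orderE oz /=.
by split=> //; rewrite -defZ; have [[_ ->]] := esG.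
Qed.

(** The defect of multiplicativity is [[~ v, u] ^+ 'C(p, 2)], and [p] divides ['C(p, 2)] because it
    is odd. *)
Lemma extraspecial_expMp : {in G &, {morph expgn^~ p : u v / u * v}}.
Proof.
move=> u v Gu Gv /=; have Zvu: [~ v, u] \in 'Z(G).
  by have [[_ <-] _] := esG; apply: mem_commg.
have /centerP[_ cvu] := Zvu.
rewrite expMg_Rmul; try exact/commute_sym/cvu.
suff -> : [~ v, u] ^+ 'C(p, 2) = 1 by rewrite mulg1.
apply/eqP; rewrite -order_dvdn.
apply: dvdn_trans (order_dvdG Zvu) _; rewrite (card_center_extraspecial pG esG).
by rewrite prime_dvd_bin //= odd_prime_gt2.
Qed.

Lemma center_exp1 c : c \in 'Z(G) -> c ^+ p = 1.
Proof.
by move=> Zc; rewrite -(card_center_extraspecial pG esG) expg_cardG.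
Qed.

Lemma extraspecial_exp_center u : u \in G -> u ^+ p \in 'Z(G).
Proof.
move=> Gu; apply/centerP; split=> [|v Gv]; first exact: groupX.
have Zvu: [~ v, u] \in 'Z(G) by have [[_ <-] _] := esG; apply: mem_commg.
have /centerP[_ cvu] := Zvu.
apply/commute_sym/commgP; rewrite commgX; last exact/commute_sym/cvu.
by rewrite center_exp1.
Qed.

Lemma exists_exp_neq1 : exists2 t, t \in G & t ^+ p != 1.
Proof.
have /exponentP expGp : ~~ (exponent G %| p).
  by rewrite expG gtnNdvd ?prime_gt0 // expnSr ltn_Pmull ?prime_gt1 ?prime_gt0.
apply/exists_inP; apply: contra_notT expGp => /exists_inPn expGp u Gu.
by apply/eqP; rewrite -[_ == _]negbK expGp.
Qed.

Lemma extraspecial_coset_exp t u : t \in G -> t ^+ p != 1 -> u \in G ->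
  exists n, (u * t ^+ n) ^+ p = 1.
Proof.
move=> Gt ntt Gu.
have sG := extraspecial_symplectic (extraspecial_exp_center Gt) ntt.
have [_ defZ _] := sG.
have Zu: (u ^+ p)^-1 \in <[t ^+ p]>.
  by rewrite groupV /= -defZ extraspecial_exp_center.
have [n def_u] := symplectic_pow p_pr sG (cycle_id _) ntt Zu.
exists n; rewrite extraspecial_expMp ?groupX //.
by rewrite -expgM mulnC expgM -def_u mulgV.
Qed.

(** A noncentral [w0] centralizing the kernel [K] of the p-th power map gives another functional
    [[~ w0, u]] vanishing on [K]. As [K] and [t] generate [G], the two are proportional, and the
    factor is read off at [t]. *)
Lemma exists_power_vector :
  exists2 w, w \in G & {in G, forall u, [~ w, u] = u ^+ p}.
Proof.
have [t Gt ntt] := exists_exp_neq1.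
have sG := extraspecial_symplectic (extraspecial_exp_center Gt) ntt.
have [oz defZ _] := sG.
pose K := 'ker (Morphism extraspecial_expMp).
have memK u : (u \in K) = (u \in G) && (u ^+ p == 1) by rewrite !inE.
have sKG: K \subset G by apply: subsetIl.
have sZK: 'Z(G) \subset K.
  apply/subsetP=> c Zc; rewrite memK center_exp1 // eqxx andbT.
  exact: subsetP (center_sub G) _ Zc.
(* Dimension count: ['C_G(K)] has order [#|'Z(G)| * #|G : K|], and [t] lies outside [K]. *)
have [w0 /setIP[Gw0 cKw0] notZw0] : exists2 w0, w0 \in 'C_G(K) & w0 \notin 'Z(G).
  apply/subsetPn; apply: contraL (leqnn #|'C_G(K)|) => /subset_leq_card leCZ.
  rewrite -ltnNge; apply: leq_ltn_trans leCZ _.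
  rewrite (card_subcent_extraspecial pG esG sKG) (setIidPl sZK).
  rewrite ltn_Pmulr ?cardG_gt0 // indexg_gt1; apply/subsetPn; exists t => //.
  by rewrite memK Gt (negbTE ntt).
have K_split u : u \in G -> exists2 k, k \in K & exists n, u = k * t ^- n.
  move=> Gu; have [n ktn] := extraspecial_coset_exp Gt ntt Gu.
  exists (u * t ^+ n); last by exists n; rewrite mulgK.
  by rewrite memK groupM ?groupX //= ktn.
have ntw0: [~ w0, t] != 1.
  apply: contra notZw0 => /commgP cw0t; apply/centerP; split=> // u Gu.
  have [k Kk [n ->]] := K_split u Gu.
  by apply: commuteM; [apply: (centP cKw0) | apply/commuteV/commuteX].
have [n def_tp] := symplectic_pow p_pr sG (symplectic_comm sG Gw0 Gt) ntw0 (cycle_id _).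
have Zw0t : [~ w0, t] \in 'Z(G) by rewrite defZ (symplectic_comm sG).
exists (w0 ^+ n); first exact: groupX.
have w0_t: [~ w0 ^+ n, t] = t ^+ p.
  by rewrite commXg -?def_tp //; have /centerP[_ c] := Zw0t; apply/commute_sym/c.
move=> _ /K_split[k Kk [m ->]]; have [Gk kp] := andP (etrans (esym (memK k)) Kk).
rewrite (symplectic_commM sG) ?groupV ?groupX //.
rewrite extraspecial_expMp ?groupV ?groupX // (eqP kp).
have -> : [~ w0 ^+ n, k] = 1.
  by apply/eqP/commgP/commute_sym/commuteX/commute_sym/(centP cKw0).
rewrite !mul1g.
(* A natural exponent is required to apply [symplectic_commX]. *)
have -> : t ^- m = t ^+ (#[t] * m - m).
  apply: (mulIg (t ^+ m)); rewrite mulVg -expgD subnK.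
    by rewrite expgM expg_order expg1n.
  by rewrite leq_pmull ?order_gt0.
by rewrite (symplectic_commX sG) ?groupX // w0_t -!expgM mulnC.
Qed.

(** * The subgroup of exponent p and its centralizer *)

Variable w : gT.
Hypotheses (Gw : w \in G) (w_exp : {in G, forall u, [~ w, u] = u ^+ p}).

Let K := 'C_G[w].

Lemma mem_exp1 u : (u \in K) = (u \in G) && (u ^+ p == 1).
Proof.
rewrite inE; case Gu: (u \in G) => //=; rewrite -w_exp //.
by apply/cent1P/commgP => /commute_sym.
Qed.

Lemma power_vector_exp_p : w ^+ p = 1.
Proof. by rewrite -w_exp // commgg. Qed.

(** For [t ^+ p] of order [p], [[~ w ^+ n, t] = (t ^+ p) ^+ n] vanishes only if [p] divides [n]. *)
Lemma power_vector_center n :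
  w ^+ n \in 'Z(G) -> w ^+ n = 1.
Proof.
have [t Gt ntt] := exists_exp_neq1.
have sG := extraspecial_symplectic (extraspecial_exp_center Gt) ntt.
have [oz _ _] := sG.
case/centerP=> _ /(_ t Gt)/commgP; rewrite commXg; last first.
  rewrite w_exp //; apply: (symplectic_commutes sG) => //; exact: cycle_id.
rewrite w_exp // -order_dvdn oz => /dvdnP[m ->].
by rewrite mulnC expgM power_vector_exp_p expg1n.
Qed.

(** A power of [w] corrects [y] so that it commutes with [t]; it still centralizes [K], and [K] and
    [t] generate [G]. *)
Lemma centralizer_exp1 y : y \in G -> y \in 'C(K) ->
  exists n, y * w ^+ n \in 'Z(G).
Proof.
move=> Gy cKy.
have [t Gt ntt] := exists_exp_neq1.
have sG := extraspecial_symplectic (extraspecial_exp_center Gt) ntt.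
have [oz defZ _] := sG.
have ntwt: [~ t, w] != 1 by rewrite -invg_comm w_exp // eq_invg1.
have [n] := symplectic_split p_pr sG (subxx G) Gt Gw ntwt Gy.
case/setIP=> Gyw /cent1P ct; exists n; apply/centerP; split=> // u Gu.
have [m utm] := extraspecial_coset_exp Gt ntt Gu.
have Ku: u * t ^+ m \in K by rewrite mem_exp1 groupM ?groupX //= utm.
have cu: commute (y * w ^+ n) (u * t ^+ m).
  apply/commute_sym/commuteM; first exact/commute_sym/(centP cKy).
  by apply: commuteX; have /setIP[_ /cent1P/commute_sym] := Ku.
have ctm: commute (y * w ^+ n) (t ^+ m) by apply/commuteX/commute_sym.
move: (y * w ^+ n) cu ctm => a cu ctm; apply: (mulIg (t ^+ m)).
by rewrite -mulgA cu -mulgA -ctm mulgA.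
Qed.

(** * Construction of automorphisms *)

(** Since [[~ w, g] = g ^+ p], the pairs [(w, g)] and [(w, h)] are hyperbolic and satisfy matching
    power relations. Their complements lie in [K], where p-th powers vanish, so a graph between the
    complements extends to [G]. *)
Lemma aut_power_vector g h a a' :
  g \in G -> g ^+ p != 1 -> h \in G -> h ^+ p != 1 ->
  let E := 'C_G([set w; g]) in let E' := 'C_G([set w; h]) in
  (a = g ^+ p /\ a' = h ^+ p) \/ (a \in E :\: 'C(E) /\ a' \in E' :\: 'C(E')) ->
  exists2 f, f \in Aut G & f g = h /\ f a = a'.
Proof.
move=> Gg ntg Gh nth E E' defa.
have sG := extraspecial_symplectic (extraspecial_exp_center Gg) ntg.
have sG' := extraspecial_symplectic (extraspecial_exp_center Gh) nth.
have [wg wh] := (w_exp Gg, w_exp Gh).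
have expE u v : u \in 'C_G([set w; v]) -> u ^+ p = 1.
  case/setIP=> Gu; rewrite centU cent_set1 => /setIP[cwu _].
  by have := mem_exp1 u; rewrite inE Gu cwu => /esym/eqP.
have [|||Gamma0 [iso0 G0z G0a]] := isograph_exponent p_pr
  (hyperbolic_symplectic p_pr sG Gw Gg wg) (hyperbolic_symplectic p_pr sG' Gw Gh wh)
  _ _ _ defa.
- apply/eqP; rewrite -(eqn_pmul2l (prime_gt0 p_pr)) -(eqn_pmul2l (prime_gt0 p_pr)).
  by rewrite -(hyperbolic_card p_pr sG) // -(hyperbolic_card p_pr sG').
- by move=> u /expE.
- by move=> u /expE.
have [||Gamma [isoG _ Ggh /subsetP sG0]] :=
  isograph_hyperbolic p_pr sG sG' Gw Gg wg Gw Gh wh iso0 G0z.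
- by rewrite power_vector_exp_p group1.
- exact: G0z.
have [f AutGf fE] := isograph_aut isoG; exists f => //.
by split; [apply: (fE (g, h)) | apply/(fE (a, a'))/sG0].
Qed.

Lemma aut_exp_neq1 g h :
  g \in G -> g ^+ p != 1 -> h \in G -> h ^+ p != 1 -> automorphic G g h.
Proof.
move=> Gg ntg Gh nth.
have [|f AutGf [fg _]] :=
  aut_power_vector (a := g ^+ p) (a' := h ^+ p) Gg ntg Gh nth.
  by left.
by exists f.
Qed.

(** Central elements are p-th powers, so it suffices to move their p-th roots. *)
Lemma aut_center c d :
  c \in 'Z(G) -> c != 1 -> d \in 'Z(G) -> d != 1 -> automorphic G c d.
Proof.
have [t Gt ntt] := exists_exp_neq1.
have sG := extraspecial_symplectic (extraspecial_exp_center Gt) ntt.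
have [_ defZ _] := sG.
have root c' : c' \in 'Z(G) -> exists2 g, g \in G & g ^+ p = c'.
  rewrite defZ => /cycleP[n ->]; exists (t ^+ n); first exact: groupX.
  by rewrite -!expgM mulnC.
move=> /root[g Gg <-] ntg /root[h Gh <-] nth.
have [|f AutGf [_ fg]] := aut_power_vector (a := g ^+ p) (a' := h ^+ p) Gg ntg Gh nth.
  by left.
by exists f.
Qed.

(** Choose [b] in [K] with [[~ a, b] = t ^+ p] and project [t] off the plane of [a] and [b]. The
    projection [g] has the same p-th power as [t], and [b] shows that [a] is noncentral in the
    complement of [w] and [g]. *)
Lemma exp1_hyperbolic_complement a : a \in K :\: 'C(K) ->
  exists g, let E := 'C_G([set w; g]) in
    [/\ g \in G, g ^+ p != 1 & a \in E :\: 'C(E)].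
Proof.
case/setDP=> Ka cKa.
have [t Gt ntt] := exists_exp_neq1.
have sG := extraspecial_symplectic (extraspecial_exp_center Gt) ntt.
have [Ga cwa] := setIP Ka.
have [b Kb ab_z] := symplectic_comm_onto p_pr sG (subsetIl _ _) Ga cKa (cycle_id _).
have [Gb cwb] := setIP Kb.
have [i [j /setIP[Gg cg]]] := hyperbolic_split p_pr sG Ga Gb ab_z Gt.
have [ap bp] : a ^+ p = 1 /\ b ^+ p = 1.
  move: Ka Kb; rewrite !mem_exp1 => /andP[_ /eqP->] /andP[_ /eqP->].
  by [].
set g := _ * _ in Gg cg; exists g.
have gp: g ^+ p = t ^+ p.
  rewrite !extraspecial_expMp ?groupM ?groupX //.
  by rewrite -!expgM ![(_ * p)%N]mulnC !expgM ap bp !expg1n !mulg1.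
have memE u : u \in K -> commute g u -> u \in 'C_G([set w; g]).
  case/setIP=> Gu cwu cgu; rewrite centU !cent_set1 !in_setI Gu cwu.
  exact/cent1P.
move: cg; rewrite centU !cent_set1 => /setIP[/cent1P ca /cent1P cb].
split=> //; first by rewrite gp.
apply/setDP; split; first exact: memE.
apply/centP=> cEa; have /commgP/idPn[] := cEa b (memE b Kb cb).
by rewrite ab_z.
Qed.

Lemma aut_exp1 a a' :
  a \in K :\: 'C(K) -> a' \in K :\: 'C(K) -> automorphic G a a'.
Proof.
move=> /exp1_hyperbolic_complement[g [Gg ntg Ea]].
case/exp1_hyperbolic_complement=> h [Gh nth Ea'].
have [|f AutGf [_ fa]] := aut_power_vector Gg ntg Gh nth (a := a) (a' := a').
  by right.
by exists f.
Qed.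

(** Conjugation by [b] multiplies [a] by [[~ a, b]], and these commutators fill the center. *)
Lemma aut_mul_center a c :
  a \in G -> a \notin 'Z(G) -> c \in 'Z(G) -> automorphic G a (a * c).
Proof.
move=> Ga notZa Zc.
have [t Gt ntt] := exists_exp_neq1.
have sG := extraspecial_symplectic (extraspecial_exp_center Gt) ntt.
have [_ defZ _] := sG; rewrite defZ in Zc.
have cGa: a \notin 'C(G) by apply: contra notZa => cGa; rewrite inE Ga.
have [b Gb <-] := symplectic_comm_onto p_pr sG (subxx G) Ga cGa Zc.
by exists (conj_aut G b); rewrite ?Aut_aut ?conj_autE ?conjg_mulR.
Qed.

(** * Invariants under automorphisms *)

Lemma automorphic_sym a b : automorphic G a b -> automorphic G b a.
Proof.
by case=> f AutGf <-; exists f^-1; rewrite ?groupV // permK.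
Qed.

Lemma automorphic_order a b : a \in G -> automorphic G a b -> #[a] = #[b].
Proof.
by move=> Ga [f AutGf <-]; rewrite -(autmE AutGf) order_injm ?injm_autm.
Qed.

Lemma automorphic_mem a b : a \in G -> automorphic G a b -> b \in G.
Proof. by move=> Ga [f AutGf <-]; apply: Aut_closed. Qed.

Lemma automorphic_char (H : {set gT}) a b :
  H \char G -> automorphic G a b -> a \in H -> b \in H.
Proof.
case/andP=> _ /forall_inP chH [f AutGf <-] Ha.
exact/(subsetP (chH f AutGf))/imset_f.
Qed.

Lemma automorphic_power_vector a b n :
  a \in G -> automorphic G a b -> {in G, forall u, [~ a, u] = u ^+ (p * n)} ->
  {in G, forall u, [~ b, u] = u ^+ (p * n)}.
Proof.
move=> Ga [f AutGf <-] an u Gu.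
have /imsetP[v Gv ->] : u \in f @: G.
  by rewrite -(autmE AutGf) -morphimEdom im_autm.
by rewrite -(autmE AutGf) -morphR // an // morphX.
Qed.

Lemma power_vector_exp n : {in G, forall u, [~ w ^+ n, u] = u ^+ (p * n)}.
Proof.
move=> u Gu; rewrite commXg w_exp ?expgM //.
by apply/commute_sym; have /centerP[_] := extraspecial_exp_center Gu; apply.
Qed.

Lemma power_vector_centralizes_exp1 n : w ^+ n \in 'C(K).
Proof.
apply/centP=> u; rewrite mem_exp1 => /andP[Gu /eqP up].
by apply/commgP; rewrite power_vector_exp // expgM up expg1n.
Qed.

Lemma automorphic_power_vector_inj m n :
  automorphic G (w ^+ m) (w ^+ n) -> w ^+ m = w ^+ n.
Proof.
move/automorphic_power_vector => autw.
have [t Gt ntt] := exists_exp_neq1.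
have [oz _ _] := extraspecial_symplectic (extraspecial_exp_center Gt) ntt.
have := autw m (groupX m Gw) (@power_vector_exp m) t Gt.
rewrite power_vector_exp // !expgM => /eqP; rewrite eq_expg_mod_order oz.
rewrite -(expg_mod m power_vector_exp_p) -(expg_mod n power_vector_exp_p).
by move/eqP->.
Qed.

Lemma exp1_char : K \char G.
Proof.
rewrite /characteristic subsetIl; apply/forall_inP=> f AutGf.
apply/subsetP=> _ /imsetP[u Ku ->]; move: Ku; rewrite !mem_exp1.
case/andP=> Gu /eqP up; rewrite Aut_closed //=.
by rewrite -(autmE AutGf) -morphX // up morph1.
Qed.

(** Away from noncentral elements of ['C(K)], order and centrality tell apart the complement of [K],
    [K :\: 'C(K)], the nontrivial center and [1], each a single orbit. *)
Lemma automorphic_iff g h : g \in G -> h \in G ->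
  (g \in 'C(K) -> g \in 'Z(G)) -> (h \in 'C(K) -> h \in 'Z(G)) ->
  automorphic G g h <-> #[g] = #[h] /\ (g \in 'Z(G) <-> h \in 'Z(G)).
Proof.
move=> Gg Gh cKg cKh; split=> [gh | [eq_o eqZ]].
  split; first exact: automorphic_order gh.
  by split; apply: automorphic_char (center_char G) _ => //; apply: automorphic_sym.
have eq_exp n : (g ^+ n == 1) = (h ^+ n == 1) by rewrite -!order_dvdn eq_o.
have [gp1 | gp] := eqVneq (g ^+ p) 1; last first.
  by apply: aut_exp_neq1; rewrite -?eq_exp.
have Kg: g \in K by rewrite mem_exp1 Gg gp1 /=.
have Kh: h \in K by rewrite mem_exp1 Gh -eq_exp gp1 /=.
have [Zg | notZg] := boolP (g \in 'Z(G)).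
  have [g1 | ntg] := eqVneq g 1.
    have /eqP h1 : h == 1 by have := eq_exp 1%N; rewrite !expg1 g1 eqxx.
    by exists 1; rewrite ?group1 // perm1 g1 h1.
  apply: aut_center => //; first exact/eqZ.
  by have := eq_exp 1%N; rewrite !expg1 => <-.
have notZh: h \notin 'Z(G) by apply: contra notZg => /eqZ.
apply: aut_exp1; first by rewrite inE Kg andbT (contra cKg).
by rewrite inE Kh andbT (contra cKh).
Qed.

Lemma centralizer_exp1_power y : y \in G -> y \in 'C(K) -> y \notin 'Z(G) ->
  exists n, automorphic G (w ^+ n) y.
Proof.
move=> Gy cKy notZy; have [n Zyw] := centralizer_exp1 Gy cKy.
have /cycleP[m def_wn] : w ^- n \in <[w]> by rewrite groupV mem_cycle.
have def_y: y = w ^+ m * (y * w ^+ n).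
  have /centerP[_ c] := Zyw.
  by rewrite -c ?groupX // -def_wn mulgK.
exists m; rewrite def_y. apply: aut_mul_center => //; first exact: groupX.
by apply: contra notZy => Zwm; rewrite def_y; apply: groupM.
Qed.

Lemma automorphic_centralizer_exp1 a b :
  a \in G -> automorphic G a b -> a \in 'C(K) -> b \in 'C(K).
Proof.
move=> Ga [f AutGf <-] /centP cKa; apply/centP=> u Ku.
have /imsetP[v Kv ->] : u \in f @: K.
  have /andP[_ /forall_inP/(_ f AutGf) sfK] := exp1_char.
  suff /eqP-> : f @: K == K by [].
  by rewrite eqEcard sfK card_imset ?leqnn //; apply: perm_inj.
have Gv: v \in G by case/setIP: Kv.
rewrite -(autmE AutGf) /commute -!morphM //; congr (autm _ _).
exact: cKa.
Qed.

(** * Counting the orbits *)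

Lemma num_aut_orbits_transversal (R : {set gT}) :
  R \subset G -> {in R &, forall r s, automorphic G r s -> r = s} ->
  {in G, forall g, exists2 r, r \in R & automorphic G r g} ->
  num_aut_orbits G = #|R|.
Proof.
move=> /subsetP sRG injR coverR.
have orbitE a b : reflect (automorphic G a b) (b \in orbit 'P (Aut G) a).
  by apply: (iffP orbitP) => [] [f AutGf fa]; exists f.
rewrite /num_aut_orbits -(card_in_imset (f := orbit 'P (Aut G)) (D := R)).
  apply: eq_card => O; apply/imsetP/imsetP=> [[g Gg ->]|[r Rr ->]]; last first.
    by exists r; rewrite ?sRG.
  have [r Rr /orbitE rg] := coverR g Gg; exists r => //.
  exact/orbit_eqP.
move=> r s Rr Rs eq_rs; apply: injR => //; apply/orbitE.
by rewrite eq_rs orbit_refl.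
Qed.

Lemma card_power_vector : #[w] = p.
Proof.
have [t Gt ntt] := exists_exp_neq1.
apply/prime_nt_dvdP; rewrite ?order_dvdn ?power_vector_exp_p // order_eq1.
by apply: contraNneq ntt => w1; rewrite -w_exp // w1 comm1g.
Qed.

Lemma card_exp1 : (p * #|K|)%N = #|G|.
Proof.
have [t Gt ntt] := exists_exp_neq1.
have sG := extraspecial_symplectic (extraspecial_exp_center Gt) ntt.
rewrite -(Lagrange (subsetIl G 'C[w])) (symplectic_index p_pr sG) // 1?mulnC //.
by apply/centP=> /(_ t Gt)/commgP; rewrite w_exp // (negbTE ntt).
Qed.

(** ['C_G(K)] has order [p ^ 2], which bounds an abelian [K]; conversely, a p-group of order at most
    [p ^ 2] is abelian. *)
Lemma exp1_abelian : abelian K = (#|G| <= p ^ 3).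
Proof.
apply/idP/idP=> [abK | leG].
  rewrite -card_exp1 expnS leq_pmul2l ?prime_gt0 //.
  have sKG: K \subset G := subsetIl _ _.
  have sZK: 'Z(G) \subset K.
    apply/subsetP=> c Zc; rewrite mem_exp1 center_exp1 // eqxx andbT.
    exact: subsetP (center_sub G) _ Zc.
  have := card_subcent_extraspecial pG esG sKG.
  rewrite (setIidPl sZK) (card_center_extraspecial pG esG).
  rewrite -divgS // -card_exp1 mulnK ?cardG_gt0 // mulnn => <-.
  by rewrite subset_leq_card // subsetI sKG.
have pK: p.-group K := pgroupS (subsetIl _ _) pG.
apply: (p2group_abelian pK).
rewrite -(leq_exp2l _ _ (prime_gt1 p_pr)) -card_pgroup //.
by rewrite -(leq_pmul2l (prime_gt0 p_pr)) card_exp1 -expnS.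
Qed.

(* [X] is a representative of [K :\: 'C(K)], or empty if there is none. *)
Lemma num_aut_orbits_power_vector z t (X : {set gT}) :
  z \in 'Z(G) -> z != 1 -> t \in G -> t ^+ p != 1 ->
  X \subset K :\: 'C(K) -> #|X| <= 1 -> (X == set0) = abelian K ->
  num_aut_orbits G = (p + 2 + #|X|)%N.
Proof.
move=> Zz ntz Gt ntt /subsetP sXK X1 X0.
have Kcyc r : r \in <[w]> -> r ^+ p = 1 /\ r \in 'C(K).
  case/cycleP=> n ->; split; last exact: power_vector_centralizes_exp1.
  by rewrite -expgM mulnC expgM power_vector_exp_p expg1n.
have Kx x : x \in X -> [/\ x \in G, x ^+ p = 1, x \notin 'C(K) & x \notin 'Z(G)].
  case/sXK/setDP=> Kx cKx; move: (Kx); rewrite mem_exp1 => /andP[Gx /eqP xp].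
  split=> //; apply: contra cKx => /centerP[_ cx]; apply/centP=> u /setIP[Gu _].
  exact: cx.
have Gz: z \in G by case/centerP: Zz.
have cKz: z \in 'C(K).
  by have /centerP[_ cz] := Zz; apply/centP=> u /setIP[Gu _]; apply: cz.
have zp := center_exp1 Zz.
have notZt: t \notin 'Z(G) by apply: contraNN ntt => /center_exp1->.
have not_wz: z \notin <[w]>.
  apply: contra ntz => /cycleP[n def_z].
  by rewrite def_z power_vector_center // -def_z.
pose R := z |: (t |: (<[w]> :|: X)).
have oR: #|R| = (p + 2 + #|X|)%N.
  have disj: [disjoint <[w]> & X].
    apply/pred0P=> x; apply/negbTE/negP=> /andP[/Kcyc[_ cx] /Kx[_ _]].
    by rewrite cx.
  rewrite !cardsU1 !inE (negbTE not_wz) cardsU disjoint_setI0 // cards0 subn0.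
  rewrite -orderE card_power_vector.
  have -> : (z == t) = false by apply: contraNF ntt => /eqP<-; rewrite zp.
  have -> : (z \in X) = false by apply/negP=> /Kx[_ _ _]; rewrite Zz.
  have -> : (t \in <[w]>) = false by apply: contraNF ntt => /Kcyc[->].
  have -> : (t \in X) = false by apply: contraNF ntt => /Kx[_ ->].
  by rewrite /= !add1n addn2.
have sRG: R \subset G.
  apply/subsetP=> r; rewrite !inE => /or4P[/eqP->|/eqP->||/Kx[]] //.
  by apply/subsetP; rewrite cycle_subG.
rewrite -oR; apply: num_aut_orbits_transversal.
- exact: sRG.
(* An automorphism invariant: 0 at [t], 1 on [X], 3 at [z], and on powers of [w] it is 2, or 4 at
   the identity. Only two powers of [w] or two elements of [X] are left to compare. *)
- pose tag r := if r ^+ p != 1 then 0 else if r \notin 'C(K) then 1%N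
    else if r \notin 'Z(G) then 2%N else if r != 1 then 3%N else 4%N.
  have tag_inv a b : a \in G -> automorphic G a b -> tag a = tag b.
    move=> Ga ab; have ba := automorphic_sym ab; have Gb := automorphic_mem Ga ab.
    have eq_o := automorphic_order Ga ab.
    rewrite /tag -!order_dvdn -!order_eq1 -eq_o.
    have -> : (a \in 'C(K)) = (b \in 'C(K)).
      by apply/idP/idP; apply: automorphic_centralizer_exp1.
    have -> // : (a \in 'Z(G)) = (b \in 'Z(G)).
    by apply/idP/idP; apply: automorphic_char (center_char G) _.
  have tagR r : r \in R -> [\/ tag r = 3%N /\ r = z, tag r = 0%N /\ r = t,
      [/\ tag r != 0%N, tag r != 1%N, tag r != 3%N & r \in <[w]>]
      | tag r = 1%N /\ r \in X].
    rewrite !inE /tag => /or4P[/eqP-> | /eqP-> | wr | Xr].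
    - by constructor 1; rewrite zp eqxx cKz Zz ntz.
    - by constructor 2; rewrite ntt.
    - constructor 3; have [-> ->] := Kcyc r wr; rewrite eqxx wr /=.
      have [Zr | //] := boolP (r \in 'Z(G)).
      have /cycleP[n def_r] := wr.
      by rewrite [r]def_r power_vector_center ?eqxx // -def_r.
    by constructor 4; have [_ -> -> _] := Kx r Xr; rewrite eqxx.
  move=> r s Rr Rs rs; have Gr: r \in G := subsetP sRG r Rr.
  have:= tag_inv r s Gr rs; move: rs.
  case: (tagR r Rr) => [[-> ->]|[-> ->]|[+ + + wr]|[-> Xr]];
    case: (tagR s Rs) => [[-> ->]|[-> ->]|[+ + + ws]|[-> Xs]] //;
    try by [move=> n0 n1 n3 _ e; rewrite -e in n0 n1 n3
           | move=> n0 n1 n3 _ e; rewrite e in n0 n1 n3].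
  - case/cycleP: wr ws => m -> /cycleP[n ->] rs *.
    exact: automorphic_power_vector_inj.
  - by move=> _ _; apply: (card_le1_eqP X1).
move=> g Gg.
have [gp | ntg] := eqVneq (g ^+ p) 1; last first.
  by exists t; [rewrite !inE eqxx orbT | apply: aut_exp_neq1].
have Kg: g \in K by rewrite mem_exp1 Gg gp eqxx.
have [cKg | cKg] := boolP (g \in 'C(K)); last first.
  have /set0Pn[x Xx] : X != set0.
    by rewrite X0; apply: contra cKg => /subsetP; apply.
  exists x; first by rewrite !inE Xx !orbT.
  by apply: aut_exp1; [apply: sXK | rewrite inE cKg].
have [Zg | notZg] := boolP (g \in 'Z(G)); last first.
  have [n wg] := centralizer_exp1_power Gg cKg notZg.
  by exists (w ^+ n) => //; rewrite !inE mem_cycle !orbT.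
have [-> | ntg] := eqVneq g 1.
  exists 1; first by rewrite !inE group1 !orbT.
  by exists 1; rewrite ?group1 // perm1.
by exists z; [rewrite !inE eqxx | apply: aut_center].
Qed.

End ExtraspecialExponentP2.

(** * Special symplectic bases and the orbit theorem *)

(** [T] and [B(-, w_1)] are linear and agree on the basis, being 1 at [v_1] and 0 at the other
    vectors. The inverse compensates for moving [w_1] to the first argument. *)
Lemma basis_power_vector (gT : finGroupType) (p : nat) (G : {group gT}) z n v w :
  prime p -> odd p -> p.-group G -> extraspecial G ->
  special_symplectic_basis p G z n v w ->
  let w' := (w 1%N)^-1 in
  w' \in G /\ {in G, forall u, [~ w', u] = u ^+ p}.
Proof.
move=> p_pr p_odd pG esG [Zz ntz n_gt0 [Gvw [genV _] Bvw Bij [v1p [vp wp]]]] w'.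
have sG := extraspecial_symplectic p_pr pG esG Zz ntz.
have Gw: w 1%N \in G by case: (Gvw 1%N); rewrite ?n_gt0.
have Gw': w' \in G by rewrite groupV.
split=> //.
(* The two sides are conjugate under [u], and the left one is central. *)
have pcommE u : u \in G -> [~ w', u] = pcomm u (w 1%N).
  move=> Gu; have Zwu := symplectic_comm sG Gw' Gu.
  rewrite -[LHS](mulgK u) -(symplectic_commutes sG Gu Zwu).
  by rewrite commgEl /conjg /pcomm /w' invgK !mulgA mulgK.
pose A := [set u in G | [~ w', u] == u ^+ p].
have memA u : (u \in A) = (u \in G) && ([~ w', u] == u ^+ p) by rewrite inE.
have gA: group_set A.
  apply/group_setP; split=> [|x y]; first by rewrite memA group1 commg1 expg1n /=.
  rewrite !memA => /andP[Gx /eqP xA] /andP[Gy /eqP yA]; rewrite groupM //=.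
  by rewrite (symplectic_commM sG) // xA yA (extraspecial_expMp p_pr p_odd pG esG).
have sZA: 'Z(G) \subset A.
  apply/subsetP=> c Zc; have /centerP[Gc cGc] := Zc.
  rewrite memA Gc (center_exp1 pG esG Zc); apply/commgP/commute_sym; exact: cGc.
have mem_basis i : (0 < i)%N && (i <= n)%N -> v i \in A /\ w i \in A.
  move=> i_n; have [Gv Gwi] := Gvw i i_n.
  rewrite !memA !pcommE // Gv Gwi wp //=.
  have [->|i_neq1] := eqVneq i 1%N.
    by rewrite v1p Bvw ?n_gt0 // /pcomm mulgK mulgV eqxx.
  have [-> _ ->] := Bij i 1%N i_n n_gt0 i_neq1.
  by rewrite vp ?eqxx //; case: i i_n i_neq1 {Gv Gwi} => [|[]].
have sGA: G \subset Group gA.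
  (* As [A] contains the center, inclusion can be checked modulo ['Z(G)], where the basis
     generates. *)
  rewrite -(@quotientSGK _ 'Z(G)) ?(char_norm (center_char G)) // -genV gen_subG.
  apply/subsetP=> _ /imsetP[x + ->]; rewrite inE => /existsP[i /andP[i_gt0 xi]].
  apply: mem_quotient; have [|vA wA] := mem_basis i; first by rewrite i_gt0 -ltnS ltn_ord.
  by case/orP: xi => /eqP->.
by move=> u /(subsetP sGA); rewrite memA => /andP[_ /eqP].
Qed.

Theorem theorem4p8 (gT : finGroupType) (p : nat) (G : {group gT}) :
  prime p -> odd p -> p.-group G -> extraspecial G -> p.-abelem 'Z(G) ->
  exponent G = (p ^ 2)%N ->
  (forall (z : gT) (n : nat) (v w : nat -> gT),
     special_symplectic_basis p G z n v w ->
     forall g h, g \in G -> h \in G ->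
       ~~ in_span_w1_nonzero G w g -> ~~ in_span_w1_nonzero G w h ->
       (automorphic G g h <->
          (#[g] = #[h] /\ (g \in 'Z(G) <-> h \in 'Z(G)))))
  /\ (#|G| = (p ^ 3)%N -> num_aut_orbits G = (p + 2)%N)
  /\ (#|G| > p ^ 3 -> num_aut_orbits G = (p + 3)%N).
Proof.
move=> p_pr p_odd pG esG _ expG; split=> [z n v w basis g h Gg Gh|].
  have [Gw w_exp] := basis_power_vector p_pr p_odd pG esG basis.
  rewrite !negb_and !negbK => spg sph.
  (* An element of [G] centralizing ['C_G[(w 1)^-1]] is central modulo powers of [w 1], so its coset
     lies in the span of [w 1]; by hypothesis that coset is then trivial. *)
  have not_span u : u \in G ->
      (coset 'Z(G) u \notin <[coset 'Z(G) (w 1%N)]>) || (coset 'Z(G) u == 1) ->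
      u \in 'C('C_G[(w 1%N)^-1]) -> u \in 'Z(G).
    have nZG: {subset G <= 'N('Z(G))} by apply/subsetP/char_norm/center_char.
    move=> Gu spu cKu.
    have [m Zuw] := centralizer_exp1 p_pr p_odd pG esG expG Gw w_exp Gu cKu.
    case/orP: spu => [|/eqP]; last exact/coset_idr/nZG.
    have Gw1: w 1%N \in G by rewrite -groupV.
    have uw1 := coset_id Zuw; rewrite morphM ?nZG ?groupX //= in uw1.
    rewrite (canRL (mulgK _) uw1) mul1g groupV morphX ?nZG //= morphV ?nZG //=.
    by rewrite groupX // groupV cycle_id.
  apply: (automorphic_iff p_pr p_odd pG esG expG Gw w_exp Gg Gh).
    exact: not_span.
  exact: not_span.
have [w Gw w_exp] := exists_power_vector p_pr p_odd pG esG expG.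
have [t Gt ntt] := exists_exp_neq1 p_pr expG.
have Zt := extraspecial_exp_center pG esG Gt.
have abK := exp1_abelian p_pr pG esG expG Gw w_exp.
have num X := num_aut_orbits_power_vector p_pr p_odd pG esG expG Gw w_exp Zt ntt Gt ntt (X := X).
(* For order [p ^ 3] the centralizer of [w] is abelian and [X] is empty; for larger order a
   noncentral element [x] of it gives the additional orbit. *)
split=> [oG | ltG].
  by rewrite (num set0) ?sub0set ?cards0 ?addn0 // eqxx abK oG leqnn.
have /subsetPn[x Kx cKx] : ~~ abelian 'C_G[w] by rewrite abK -ltnNge.
rewrite (num [set x]) ?cards1 -?addnA //; first by rewrite sub1set in_setD cKx.
by rewrite abK leqNgt ltG; apply/negbTE/set0Pn; exists x; rewrite set11.
Qed.
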